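(* Let $\mathfrak g$ be a real nilpotent Lie algebra with a metric $\langle,\rangle_{\mathfrak g}$ satisfying $\operatorname{Ric}=\lambda\,\mathrm{id}+D$ with $\lambda\neq0$ and $D\in\operatorname{Der}\mathfrak g$. Let $\mathfrak a\subset\operatorname{Der}\mathfrak g$ be a Lie subalgebra consisting of derivations that are self-adjoint with respect to $\langle,\rangle_{\mathfrak g}$, with $D\in\mathfrak a$, and assume that the bilinear form $\langle X,Y\rangle_{\mathrm{Tr}}=\operatorname{Tr}(X\circ Y)$ is nondegenerate on $\mathfrak a$. Let $\tilde{\mathfrak g}=\mathfrak g\rtimes\mathfrak a$ be the semidirect product with $[X,v]=X(v)$ for $X\in\mathfrak a$, $v\in\mathfrak g$, and endow it with the metric $\langle,\rangle_{\mathfrak g}-\frac1\lambda\langle,\rangle_{\mathrm{Tr}}$ (with $\mathfrak g\perp\mathfrak a$). Then this metric is Einstein with $\widetilde{\operatorname{Ric}}=\lambda\,\mathrm{id}$, and $\tilde{\mathfrak g}=\mathfrak g\oplus^\perp\mathfrak a$ is a pseudo-Iwasawa decomposition.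
   Context: A metric on a Lie algebra is a nondegenerate symmetric bilinear form, possibly indefinite; Ricci operators are those of the corresponding left-invariant pseudo-Riemannian metrics on simply connected Lie groups. A pseudo-Iwasawa decomposition of a metric Lie algebra $\tilde{\mathfrak g}$ is an orthogonal direct sum of vector spaces $\tilde{\mathfrak g}=\mathfrak g\oplus^\perp\mathfrak a$ with $\mathfrak g$ a nilpotent ideal, $\mathfrak a$ an abelian subalgebra, and $\operatorname{ad}X$ self-adjoint for every $X\in\mathfrak a$. *)

(* Defs.v *)
(* Metric Lie algebras are modelled on column vectors 'cV[R]_N
   (coordinates w.r.t. a fixed basis e_0..e_{N-1}), with a bracket given as a
   function and a metric given by a symmetric invertible Gram matrix G. *)
From mathcomp Require Import all_boot all_order all_algebra.
Set Implicit Arguments. Unset Strict Implicit. Unset Printing Implicit Defensive.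
Import Order.TTheory GRing.Theory Num.Theory.
Local Open Scope ring_scope.

Section Defs.
Variable R : fieldType.

Definition ebas {N : nat} (i : 'I_N) : 'cV[R]_N := delta_mx i ord0.

Definition ip {N : nat} (G : 'M[R]_N) (u v : 'cV[R]_N) : R := (u^T *m G *m v) ord0 ord0.

Definition is_metric {N : nat} (G : 'M[R]_N) : Prop := G^T = G /\ G \in unitmx.

Definition is_lie_bracket {N : nat} (br : 'cV[R]_N -> 'cV[R]_N -> 'cV[R]_N) : Prop :=
  [/\ (forall a u v w, br (a *: u + v) w = a *: br u w + br v w),
      (forall a u v w, br w (a *: u + v) = a *: br w u + br w v),
      (forall u, br u u = 0) &
      (forall u v w, br u (br v w) + br v (br w u) + br w (br u v) = 0)].

Definition iter_br {N : nat} (br : 'cV[R]_N -> 'cV[R]_N -> 'cV[R]_N)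
  (s : seq 'cV[R]_N) (x : 'cV[R]_N) : 'cV[R]_N := foldr br x s.

Definition nilpotent_br {N : nat} (br : 'cV[R]_N -> 'cV[R]_N -> 'cV[R]_N) : Prop :=
  exists k : nat, forall (s : seq 'cV[R]_N) (x : 'cV[R]_N),
    size s = k -> iter_br br s x = 0.

(* Levi-Civita connection of the left-invariant metric, via Koszul formula:
   2 <nabla_X Y, Z> = <[X,Y],Z> - <[Y,Z],X> + <[Z,X],Y>. *)
Definition levi_civita {N : nat} (br : 'cV[R]_N -> 'cV[R]_N -> 'cV[R]_N)
  (G : 'M[R]_N) (X Y : 'cV[R]_N) : 'cV[R]_N :=
  invmx G *m \col_k ((ip G (br X Y) (ebas k) - ip G (br Y (ebas k)) X
                       + ip G (br (ebas k) X) Y) / 2%:R).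

Definition curv {N : nat} (br : 'cV[R]_N -> 'cV[R]_N -> 'cV[R]_N)
  (G : 'M[R]_N) (X Y Z : 'cV[R]_N) : 'cV[R]_N :=
  levi_civita br G X (levi_civita br G Y Z) - levi_civita br G Y (levi_civita br G X Z)
  - levi_civita br G (br X Y) Z.

(* Ricci tensor ric(Y,Z) = Tr (X |-> R(X,Y)Z) *)
Definition ric {N : nat} (br : 'cV[R]_N -> 'cV[R]_N -> 'cV[R]_N)
  (G : 'M[R]_N) (Y Z : 'cV[R]_N) : R :=
  \sum_(i < N) (curv br G (ebas i) Y Z) i ord0.

(* Ricci operator: <Ric Y, Z> = ric(Y,Z) *)
Definition Ric {N : nat} (br : 'cV[R]_N -> 'cV[R]_N -> 'cV[R]_N)
  (G : 'M[R]_N) (Y : 'cV[R]_N) : 'cV[R]_N :=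
  invmx G *m \col_k ric br G Y (ebas k).

Definition is_derivation {N : nat} (br : 'cV[R]_N -> 'cV[R]_N -> 'cV[R]_N)
  (D : 'M[R]_N) : Prop :=
  forall u v, D *m br u v = br (D *m u) v + br u (D *m v).

Definition self_adjoint {N : nat} (G D : 'M[R]_N) : Prop := D^T *m G = G *m D.

(* ---- subalgebra a of End(R^n), given by a basis: the rows of S : 'M_(m, n*n),
   each row being mxvec of a matrix ---- *)
Definition basA {n m : nat} (S : 'M[R]_(m, n * n)) (j : 'I_m) : 'M[R]_n :=
  vec_mx (row j S).
Definition opA {n m : nat} (S : 'M[R]_(m, n * n)) (x : 'cV[R]_m) : 'M[R]_n :=
  vec_mx (x^T *m S).
(* coordinates of M in the basis of a (meaningful for M in a) *)
Definition coordA {n m : nat} (S : 'M[R]_(m, n * n)) (M : 'M[R]_n) : 'cV[R]_m :=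
  (mxvec M *m pinvmx S)^T.

Definition comm_mx' {n : nat} (X Y : 'M[R]_n) : 'M[R]_n := X *m Y - Y *m X.

Definition trform {n m : nat} (S : 'M[R]_(m, n * n)) : 'M[R]_m :=
  \matrix_(i, j) \tr (basA S i *m basA S j).

(* semidirect product g x| a on R^(n+m): [(v,X),(w,Y)] = ([v,w] + X w - Y v, [X,Y]) *)
Definition sd_br {n m : nat} (br : 'cV[R]_n -> 'cV[R]_n -> 'cV[R]_n)
  (S : 'M[R]_(m, n * n)) (u w : 'cV[R]_(n + m)) : 'cV[R]_(n + m) :=
  col_mx (br (usubmx u) (usubmx w) + opA S (dsubmx u) *m usubmx w
            - opA S (dsubmx w) *m usubmx u)
         (coordA S (comm_mx' (opA S (dsubmx u)) (opA S (dsubmx w)))).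

Definition sd_metric {n m : nat} (G : 'M[R]_n) (S : 'M[R]_(m, n * n)) (lam : R)
  : 'M[R]_(n + m) :=
  block_mx G 0 0 (- lam^-1 *: trform S).

Definition inU {N k : nat} (U : 'M[R]_(k, N)) (v : 'cV[R]_N) : bool := (v^T <= U)%MS.

Definition pseudo_iwasawa {N k l : nat} (br : 'cV[R]_N -> 'cV[R]_N -> 'cV[R]_N)
  (G : 'M[R]_N) (U : 'M[R]_(k, N)) (V : 'M[R]_(l, N)) : Prop :=
  [/\ ((U + V == 1%:M)%MS && mxdirect (U + V)) /\
      (forall u v, inU U u -> inU V v -> ip G u v = 0),
      (forall x u, inU U u -> inU U (br x u)),
      (exists k0 : nat, forall (s : seq 'cV[R]_N) (x : 'cV[R]_N),
          all (inU U) s -> inU U x -> size s = k0 -> iter_br br s x = 0),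
      (forall x y, inU V x -> inU V y -> br x y = 0) &
      (forall X y z, inU V X -> ip G (br X y) z = ip G y (br X z))].

End Defs.

(* Main.v *)
(* Write [A_Y] for [ad Y], [*] for the metric adjoint, and [J_Y X = (A_X)* Y]
   ([coad Y]).  The connection is [nabla_X Y = P_Y X] with
   [P_Y = - (A_Y + A_Y* + J_Y) / 2] ([conn Y]), and since it is torsion-free the
   Ricci tensor collapses to
     ric(Y, Z) = - tr A_(nabla_Y Z) - tr (P_Y P_Z).
   On the nilpotent algebra all traces [tr A_v] and [tr (A_v X)] with [X] a
   derivation vanish, and [tr (Ric X) = 0] for every derivation [X]; for
   [Ric = lam + D] this says that [D] represents the linear form [X |-> tr X] on
   [a] for the metric [- Tr / lam].  On the extension, [A] and [J] are 2 x 2 block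
   matrices, the contributions of the off-diagonal blocks cancel, and
     ric~((v, X), (w, Y)) = ric(v, w) - <D v, w> - tr (X Y)
                          = lam <(v, X), (w, Y)>~. *)
Require Import Defs.
From HB Require Import structures.
From mathcomp Require Import all_boot all_order all_algebra.
From mathcomp Require Import reals.
From mathcomp Require Import ring.
Import Order.TTheory GRing.Theory Num.Theory.
Local Open Scope ring_scope.

Set Implicit Arguments.
Unset Strict Implicit.
Unset Printing Implicit Defensive.

(** * Linear maps as matrices, and the trace of a nilpotent matrix *)

Section LinearMaps.
Variable F : fieldType.

Definition linmx {N p : nat} (f : 'cV[F]_N -> 'cV[F]_p) : 'M[F]_(p, N) :=
  \matrix_(i, j) f (ebas F j) i ord0.

Lemma linmxE N p (f : 'cV[F]_N -> 'cV[F]_p) u :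
  (forall a u v, f (a *: u + v) = a *: f u + f v) -> linmx f *m u = f u.
Proof.
move=> lin_f.
have f0 : f 0 = 0 by have := lin_f (-1) 0 0; rewrite !scaler0 addr0 scaleN1r addNr.
have fD : {morph f : u v / u + v} by move=> x y; rewrite -[x]scale1r lin_f !scale1r.
have fZ a v : f (a *: v) = a *: f v by rewrite -[a *: v]addr0 lin_f f0 addr0.
have -> : u = \sum_j u j ord0 *: ebas F j.
  rewrite {1}[u]matrix_sum_delta; apply: eq_bigr => j _.
  by rewrite big_ord1.
rewrite mulmx_sumr (big_morph _ fD f0); apply: eq_bigr => j _.
rewrite fZ -scalemxAr; congr (_ *: _).
by apply/colP => i; rewrite -colE !mxE.
Qed.

Lemma eq_mulmx_col N p (A B : 'M[F]_(p, N)) :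
  (forall u : 'cV[F]_N, A *m u = B *m u) -> A = B.
Proof.
move=> eqAB; apply/matrixP => i j.
by have /colP/(_ i) := eqAB (delta_mx j ord0); rewrite -!colE !mxE.
Qed.

Lemma mxtrace_ebas N (A : 'M[F]_N) : \tr A = \sum_i (A *m ebas F i) i ord0.
Proof. by apply: eq_bigr => i _; rewrite -colE mxE. Qed.

Lemma expr_mulmxC N p (B : 'M[F]_(p, N)) (C : 'M[F]_(N, p)) j :
  (B *m C) ^+ j.+1 = B *m (C *m B) ^+ j *m C.
Proof.
elim: j => [|j IHj]; first by rewrite expr1 expr0 mulmx1.
by rewrite exprSr IHj [in RHS]exprSr /GRing.mul /= !mulmxA.
Qed.

(** If [A] is invertible, cancelling it brings the power down to [1 = 0]. Otherwise a rank
    factorisation [A = B C] gives a smaller nilpotent matrix [C B] with the same trace, and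
    induction on the size applies. *)
Lemma mxtrace_nilpotent N (A : 'M[F]_N) k : A ^+ k = 0 -> \tr A = 0.
Proof.
have [d] := ubnP N; elim: d => // d IHd in N A k *; rewrite ltnS => leNd nilA.
have [rN|rN] := eqVneq (\rank A) N.
  have uA : A \in unitmx by rewrite -row_full_unit /row_full rN.
  have A0 : A = 0.
    elim: k nilA => [|k IHk]; last first.
      by rewrite exprS => /(congr1 (mulmx (invmx A))); rewrite mulKmx // mulmx0.
    by rewrite expr0 => e; rewrite -[A]mul1mx -[1%:M]/(1 : 'M_N) e mul0mx.
  by rewrite A0 mxtrace0.
have ltr : (\rank A < N)%N by rewrite ltn_neqAle rN rank_leq_row.
rewrite -{1}(mulmx_base A) mxtrace_mulC.
(* The exponent grows by one because [(C B)^(k+1) = C (B C)^k B]. *)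
apply: (IHd _ _ k.+1); first exact: leq_trans leNd.
by rewrite expr_mulmxC mulmx_base nilA mulmx0 mul0mx.
Qed.

End LinearMaps.

(* Locked so that rewriting with [mulmxA] does not see through it. *)
HB.lock Definition adjoint (F : fieldType) (N : nat) (G A : 'M[F]_N) : 'M[F]_N :=
  invmx G *m A^T *m G.

(** * Indefinite inner products and metric adjoints *)

Section InnerProduct.
Variables (F : fieldType) (N : nat) (G : 'M[F]_N).
Hypothesis metG : is_metric G.
Implicit Types (u v w : 'cV[F]_N) (A B : 'M[F]_N).

Local Notation adjoint := (adjoint G).

Let symG : G^T = G. Proof. by case: metG. Qed.
Let unitG : G \in unitmx. Proof. by case: metG. Qed.

Lemma ipC u v : ip G u v = ip G v u.
Proof.
rewrite /ip -[in LHS](trmxK (u^T *m G *m v)) [LHS]mxE.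
by rewrite !trmx_mul trmxK symG mulmxA.
Qed.

Lemma ipDl u v w : ip G (u + v) w = ip G u w + ip G v w.
Proof. by rewrite /ip linearD /= !mulmxDl mxE. Qed.

Lemma ip0l w : ip G 0 w = 0.
Proof. by rewrite /ip trmx0 !mul0mx mxE. Qed.

Lemma ip0r w : ip G w 0 = 0.
Proof. by rewrite /ip mulmx0 mxE. Qed.

Lemma ipNl u w : ip G (- u) w = - ip G u w.
Proof. by rewrite /ip linearN /= !mulNmx mxE. Qed.

Lemma ipZl a u w : ip G (a *: u) w = a * ip G u w.
Proof. by rewrite /ip linearZ /= -!scalemxAl mxE. Qed.

Lemma ip_suml I (r : seq I) (f : I -> 'cV[F]_N) w :
  ip G (\sum_(i <- r) f i) w = \sum_(i <- r) ip G (f i) w.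
Proof. by rewrite /ip linear_sum /= !mulmx_suml summxE. Qed.

Lemma ipDr u v w : ip G w (u + v) = ip G w u + ip G w v.
Proof. by rewrite ipC ipDl !(ipC w). Qed.

Lemma ipNr u w : ip G w (- u) = - ip G w u.
Proof. by rewrite ipC ipNl ipC. Qed.

Lemma ipZr a u w : ip G w (a *: u) = a * ip G w u.
Proof. by rewrite ipC ipZl ipC. Qed.

Lemma ip_ebasr u k : ip G u (ebas F k) = (G *m u) k ord0.
Proof.
by rewrite /ip -colE mxE -{1}symG -trmx_mul mxE.
Qed.

Lemma ip_inj u v : (forall w, ip G u w = ip G v w) -> u = v.
Proof.
move=> e; apply: (can_inj (mulKmx unitG)).
by apply/colP => k; rewrite -!ip_ebasr.
Qed.

Lemma ip_adjointl A u v : ip G (adjoint A *m u) v = ip G u (A *m v).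
Proof.
rewrite /ip unlock !trmx_mul trmxK trmx_inv symG !mulmxA.
by rewrite mulmxKV // !mulmxA.
Qed.

Lemma ip_adjointr A u v : ip G u (adjoint A *m v) = ip G (A *m u) v.
Proof. by rewrite ipC ip_adjointl ipC. Qed.

Lemma adjointK A : adjoint (adjoint A) = A.
Proof.
by apply: eq_mulmx_col => u; apply: ip_inj => w; rewrite ip_adjointl ip_adjointr.
Qed.

Lemma adjointD A B : adjoint (A + B) = adjoint A + adjoint B.
Proof. by rewrite unlock linearD /= mulmxDr mulmxDl. Qed.

Lemma adjointN A : adjoint (- A) = - adjoint A.
Proof. by rewrite unlock linearN /= mulmxN mulNmx. Qed.

Lemma adjointZ a A : adjoint (a *: A) = a *: adjoint A.
Proof. by rewrite unlock linearZ /= -scalemxAr -scalemxAl. Qed.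

Lemma adjointM A B : adjoint (A *m B) = adjoint B *m adjoint A.
Proof. by rewrite unlock trmx_mul !mulmxA mulmxK. Qed.

Lemma mxtrace_adjoint A : \tr (adjoint A) = \tr A.
Proof. by rewrite unlock mxtrace_mulC mulmxA mulmxV // mul1mx mxtrace_tr. Qed.

Lemma self_adjointE A : self_adjoint G A <-> adjoint A = A.
Proof.
split=> [sA|]; first by rewrite unlock -mulmxA sA mulKmx.
by rewrite /self_adjoint unlock => {2}<-; rewrite !mulmxA mulmxV // mul1mx.
Qed.

(* [invmx G *m ebas k] runs through the basis dual to [ebas]. *)
Lemma mxtrace_ip A : \tr A = \sum_k ip G (A *m (invmx G *m ebas F k)) (ebas F k).
Proof.
under eq_bigr => k _ do rewrite ip_ebasr !mulmxA.
by rewrite -mxtrace_ebas mxtrace_mulC mulKmx.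
Qed.

Lemma mxtrace_ip_dual A : \tr A = \sum_k ip G (A *m ebas F k) (invmx G *m ebas F k).
Proof.
rewrite -mxtrace_adjoint mxtrace_ip; apply: eq_bigr => k _.
by rewrite ip_adjointl ipC.
Qed.

End InnerProduct.

(** Isolates what the connection and Ricci formulas rest on, so that they apply to [br] and to
    [sd_br] alike. *)
Definition skew_bilinear (F : fieldType) (N : nat)
    (br : 'cV[F]_N -> 'cV[F]_N -> 'cV[F]_N) :=
  [/\ (forall a u v w, br (a *: u + v) w = a *: br u w + br v w),
      (forall a u v w, br w (a *: u + v) = a *: br w u + br w v) &
      (forall u v, br u v = - br v u)].

Lemma lie_skew_bilinear (F : fieldType) (N : nat)
    (br : 'cV[F]_N -> 'cV[F]_N -> 'cV[F]_N) :
  is_lie_bracket br -> skew_bilinear br.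
Proof.
case=> brl brr alt _; split=> // u v; apply/eqP; rewrite -addr_eq0; apply/eqP.
have := alt (u + v); rewrite -[in X in br X _ = _](scale1r u) brl.
rewrite -[in br u _](scale1r u) -[in br v (u + v)](scale1r u) !brr !scale1r.
by rewrite !alt add0r addr0.
Qed.

(** * Levi-Civita connection and a trace formula for the Ricci tensor *)

Section Curvature.
Variables (F : fieldType) (N : nat) (br : 'cV[F]_N -> 'cV[F]_N -> 'cV[F]_N).
Variable G : 'M[F]_N.
Hypothesis sbr : skew_bilinear br.
Hypothesis metG : is_metric G.
Hypothesis two_neq0 : (2%:R : F) != 0.
Implicit Types (u v w X Y Z W : 'cV[F]_N).

Definition ad X : 'M[F]_N := linmx (br X).
Definition coad Y : 'M[F]_N := linmx (fun X => adjoint G (ad X) *m Y).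

Lemma adE X Y : ad X *m Y = br X Y.
Proof. by case: sbr => _ brr _; apply: linmxE => *; apply: brr. Qed.

Lemma ad_lin a X Y : ad (a *: X + Y) = a *: ad X + ad Y.
Proof.
case: sbr => brl _ _.
by apply: eq_mulmx_col => u; rewrite mulmxDl -scalemxAl !adE brl.
Qed.

Lemma adD X Y : ad (X + Y) = ad X + ad Y.
Proof. by rewrite -[X]scale1r ad_lin !scale1r. Qed.

Lemma ad0 : ad 0 = 0.
Proof. by apply: (addrI (ad 0)); rewrite -adD !addr0. Qed.

Lemma adZ a X : ad (a *: X) = a *: ad X.
Proof. by rewrite -[a *: X]addr0 ad_lin ad0 addr0. Qed.

Lemma coadE Y X : coad Y *m X = adjoint G (ad X) *m Y.
Proof.
by apply: linmxE => a u v; rewrite ad_lin adjointD adjointZ mulmxDl -scalemxAl.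
Qed.

Lemma ip_coad Y X Z : ip G (coad Y *m X) Z = ip G Y (br X Z).
Proof. by rewrite coadE ip_adjointl // adE. Qed.

Lemma coad_lin a X Y : coad (a *: X + Y) = a *: coad X + coad Y.
Proof.
apply: eq_mulmx_col => u; rewrite mulmxDl -scalemxAl !coadE.
by rewrite mulmxDr -scalemxAr.
Qed.

(** The form [ip G (coad Y *m u) w] equals [ip G Y (br u w)], which is skew in [u] and [w]. *)
Lemma adjoint_coad Y : adjoint G (coad Y) = - coad Y.
Proof.
case: sbr => _ _ skew; apply: eq_mulmx_col => u; apply: (ip_inj metG) => w.
by rewrite ip_adjointl // mulNmx ipNl ipC // !ip_coad skew ipNr.
Qed.

Definition conn Y : 'M[F]_N := - (2%:R^-1 *: (ad Y + adjoint G (ad Y) + coad Y)).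

(** Each Koszul term matches one summand of [conn Y]. Taking [X] as the argument turns the Ricci
    trace over [X] into a matrix trace. *)
Lemma levi_civita_conn X Y : levi_civita br G X Y = conn Y *m X.
Proof.
case: sbr => _ _ skew; rewrite /levi_civita.
apply: (can_inj (mulKmx (proj2 metG))); rewrite mulKVmx ?(proj2 metG) //.
apply/colP => k; rewrite mxE -ip_ebasr // /conn mulNmx ipNl -scalemxAl ipZl.
rewrite !mulmxDl !ipDl ip_adjointl // !adE ip_coad (skew X Y) ipNl.
rewrite (skew (ebas F k) X) ipNl.
rewrite (ipC metG (br Y (ebas F k))) (ipC metG (br X (ebas F k))).
by field.
Qed.

(** Torsion-freeness: nabla_X Y is nabla_Y X plus [br X Y]. Differentiation along a fixed [X] thus
    becomes a matrix. *)
Lemma levi_civita_torsion X Y :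
  levi_civita br G X Y = (conn X + ad X) *m Y.
Proof.
rewrite levi_civita_conn; apply: (ip_inj metG) => w.
rewrite /conn mulmxDl !mulNmx -!scalemxAl !mulmxDl !coadE !adE.
case: sbr => _ _ skew; rewrite (skew Y X).
rewrite !(ipDl, ipNl, ipZl); by field.
Qed.

(** The product of a self-adjoint and a skew-adjoint operator has a trace equal to its own
    opposite. *)
Lemma mxtrace_adjoint_coad A X : adjoint G A = A -> \tr (A *m coad X) = 0.
Proof.
move=> sA; apply/eqP; rewrite -(mulrI_eq0 _ (mulfI two_neq0)) mulr_natl mulr2n.
rewrite -{1}(mxtrace_adjoint metG) adjointM // adjoint_coad sA mulNmx raddfN /=.
by rewrite mxtrace_mulC addNr.
Qed.

Lemma mxtrace_coad X : \tr (coad X) = 0.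
Proof.
rewrite -[coad X]mul1mx mxtrace_adjoint_coad //.
by rewrite unlock trmx1 mulmx1 mulVmx ?(proj2 metG).
Qed.

Lemma mxtrace_conn X : \tr (conn X) = - \tr (ad X).
Proof.
rewrite /conn raddfN /= mxtraceZ !mxtraceD mxtrace_adjoint // mxtrace_coad.
by field.
Qed.

(** Up to the factor -1/2, [conn] is a self-adjoint part plus the skew part [coad]; the mixed traces
    vanish. *)
Lemma mxtrace_connM X Y : \tr (conn X *m conn Y) =
  2%:R^-1 * (\tr (ad X *m ad Y) + \tr (ad X *m adjoint G (ad Y)))
  + 4%:R^-1 * \tr (coad X *m coad Y).
Proof.
have sA Z : adjoint G (ad Z + adjoint G (ad Z)) = ad Z + adjoint G (ad Z).
  by rewrite adjointD adjointK // addrC.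
rewrite /conn mulNmx mulmxN opprK -scalemxAl -scalemxAr scalerA mxtraceZ.
have split_coad A B : adjoint G A = A -> adjoint G B = B ->
    \tr ((A + coad X) *m (B + coad Y)) = \tr (A *m B) + \tr (coad X *m coad Y).
  move=> hA hB; rewrite mulmxDl !mulmxDr !mxtraceD (mxtrace_mulC (coad X) B).
  by rewrite (mxtrace_adjoint_coad _ hA) (mxtrace_adjoint_coad _ hB) addr0 add0r.
rewrite split_coad //.
set A := ad X + _; set B := ad Y + _.
have -> : \tr (A *m B) = 2%:R * (\tr (ad X *m ad Y) + \tr (ad X *m adjoint G (ad Y))).
  rewrite /A /B mulmxDl !mulmxDr !mxtraceD.
  have flip C E : \tr (adjoint G C *m E) = \tr (C *m adjoint G E).
    by rewrite -(mxtrace_adjoint metG (_ *m E)) adjointM // adjointK // mxtrace_mulC.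
  rewrite !flip adjointK //; ring.
have four_neq0 : (4%:R : F) != 0 by rewrite (natrM _ 2 2) mulf_neq0.
by field; rewrite four_neq0.
Qed.

Lemma ric_trace Y Z : ric br G Y Z =
  - \tr (ad (levi_civita br G Y Z))
  - 2%:R^-1 * (\tr (ad Y *m ad Z) + \tr (ad Y *m adjoint G (ad Z)))
  - 4%:R^-1 * \tr (coad Y *m coad Z).
Proof.
(* The three terms of the curvature R(X, Y)Z, each written as a matrix applied to [X]. In the trace,
   [ad Y *m conn Z] and [conn Z *m ad Y] will cancel. *)
have -> : ric br G Y Z =
    \tr (conn (levi_civita br G Y Z) - (conn Y + ad Y) *m conn Z + conn Z *m ad Y).
  rewrite mxtrace_ebas; apply: eq_bigr => i _; congr (fun_of_matrix _ i ord0).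
  case: sbr => _ _ skew.
  rewrite /curv (levi_civita_torsion Y (levi_civita br G _ Z)).
  rewrite !(levi_civita_conn (ebas _ _)).
  rewrite [levi_civita _ _ (br _ _) _]levi_civita_conn.
  by rewrite (skew _ Y) -adE mulmxN opprK [RHS]mulmxDl [X in _ = X + _]mulmxBl !mulmxA.
rewrite mxtraceD raddfB /= mxtrace_conn mulmxDl mxtraceD mxtrace_connM.
rewrite (mxtrace_mulC (conn Z)); ring.
Qed.

Lemma ric_Ric Y Z : ric br G Y Z = ip G (Ric br G Y) Z.
Proof.
have -> : ric br G Y Z = \sum_k Z k ord0 * ric br G Y (ebas F k).
  (* The scalar [ric br G Y Z] is packed as a vector of length one so that [linmxE] expands it over
     the basis. *)
  pose f Z := (const_mx (ric br G Y Z) : 'cV[F]_1).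
  have linf a u v : f (a *: u + v) = a *: f u + f v.
    apply/colP => i; rewrite !mxE !ric_trace !(levi_civita_torsion Y).
    rewrite mulmxDr -scalemxAr !ad_lin coad_lin adjointD adjointZ.
    rewrite !mulmxDr -!scalemxAr !mxtraceD !mxtraceZ; ring.
  have := linmxE Z linf => /colP/(_ ord0); rewrite !mxE => <-.
  by apply: eq_bigr => k _; rewrite !mxE mulrC.
rewrite ipC // /ip /Ric mulmxA mulmxK ?(proj2 metG) // mxE.
by apply: eq_bigr => k _; rewrite !mxE.
Qed.

Lemma Ric_eq Y V : (forall Z, ric br G Y Z = ip G V Z) -> Ric br G Y = V.
Proof. by move=> e; apply: (ip_inj metG) => Z; rewrite -ric_Ric. Qed.

End Curvature.

(** * Vanishing traces on a nilpotent Lie algebra *)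

Section NilpotentTraces.
Variables (F : fieldType) (N : nat) (br : 'cV[F]_N -> 'cV[F]_N -> 'cV[F]_N).
Hypothesis lieb : is_lie_bracket br.
Hypothesis nilb : nilpotent_br br.
Implicit Types (u v w x : 'cV[F]_N) (X M : 'M[F]_N).

Let sbr : skew_bilinear br := lie_skew_bilinear lieb.

Lemma derivation_ad X v :
  is_derivation br X -> ad br (X *m v) = X *m ad br v - ad br v *m X.
Proof.
move=> derX; apply: eq_mulmx_col => u.
by rewrite mulmxBl -!mulmxA !adE // derX addrK.
Qed.

Lemma ad_derivation v : is_derivation br (ad br v).
Proof.
case: lieb => _ _ _ jac; case: sbr => _ _ skew u w; rewrite !adE //.
have := jac v u w; rewrite (skew w v) (skew w (br v u)) -(adE sbr u (- _)) mulmxN adE //.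
by rewrite -addrA -opprD => /eqP; rewrite subr_eq0 => /eqP->; rewrite addrC.
Qed.

(** Membership in the [j]-th term of the upper central series. *)
Definition upper_central j x := forall s, size s = j -> iter_br br s x = 0.

Lemma iter_brD s x y : iter_br br s (x + y) = iter_br br s x + iter_br br s y.
Proof. by elim: s => //= v s ->; rewrite -!(adE sbr) mulmxDr. Qed.

Lemma iter_brN s x : iter_br br s (- x) = - iter_br br s x.
Proof. by elim: s => //= v s ->; rewrite -!(adE sbr) mulmxN. Qed.

Lemma upper_centralS j x : upper_central j.+1 x <-> forall v, upper_central j (br v x).
Proof.
split=> [ux v s sz|ux s].
  (* [foldr] applies the last entry of the list first, so the innermost bracket sits at the end. *)
  by have := ux (rcons s v); rewrite size_rcons sz /iter_br foldr_rcons => ->.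
by case/lastP: s => // s v; rewrite size_rcons /iter_br foldr_rcons => -[/(ux v)].
Qed.

(** Induction on [j], using that [v, X x] = X [v, x] - [X v, x] for a derivation [X]. *)
Lemma upper_central_derivation X j x :
  is_derivation br X -> upper_central j x -> upper_central j (X *m x).
Proof.
move=> derX; elim: j x => [|j IHj] x.
  by move=> /(_ [::] erefl)/= -> s /size0nil->; rewrite mulmx0.
move=> /upper_centralS ux; apply/upper_centralS => v s sz.
have -> : br v (X *m x) = X *m br v x - br (X *m v) x by rewrite derX addrC addKr.
by rewrite iter_brD iter_brN (IHj (br v x)) // (ux (X *m v)) // subr0.
Qed.

(** Term [k] of the series is the whole space and term 0 is zero, so an operator lowering the series
    by one step satisfies [M ^+ k = 0]. *)
Lemma mxtrace_upper_central M :
  (forall j x, upper_central j.+1 x -> upper_central j (M *m x)) -> \tr M = 0.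
Proof.
move=> lowM; have [k nilk] := nilb; apply: (@mxtrace_nilpotent _ _ _ k).
apply: eq_mulmx_col => x; rewrite mul0mx.
suff: forall i, (i <= k)%N -> upper_central (k - i) (M ^+ i *m x).
  by move=> /(_ k (leqnn k)); rewrite subnn => /(_ [::] erefl).
elim=> [_|i IHi lti]; first by rewrite subn0 => s sz; apply: nilk.
rewrite exprS -[_ *m x]mulmxA; apply: lowM.
by rewrite subnSK //; apply: IHi; apply: ltnW.
Qed.

Lemma mxtrace_ad v : \tr (ad br v) = 0.
Proof. by apply: mxtrace_upper_central => j x /upper_centralS; rewrite adE //; apply. Qed.

(** [X] preserves every term of the upper central series and [ad br v] lowers it by one. *)
Lemma mxtrace_ad_derivation v X : is_derivation br X -> \tr (ad br v *m X) = 0.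
Proof.
move=> derX; apply: mxtrace_upper_central => j x ux; rewrite -mulmxA adE //.
by move/(upper_central_derivation derX)/upper_centralS: ux; apply.
Qed.

(** * The Ricci operator is trace-orthogonal to derivations *)

Section RicciTrace.
Variable G : 'M[F]_N.
Hypothesis metG : is_metric G.
Hypothesis two_neq0 : (2%:R : F) != 0.

Lemma nilpotent_ric v w : ric br G v w =
  - (2%:R^-1 * \tr (ad br v *m adjoint G (ad br w)))
  - 4%:R^-1 * \tr (coad br G v *m coad br G w).
Proof.
rewrite ric_trace // mxtrace_ad (mxtrace_ad_derivation _ (ad_derivation w)); ring.
Qed.

(** [Kl] and [Kr] represent, through the metric, the two trace forms in [nilpotent_ric], the second
    with opposite sign. Their sums pair a basis with its dual basis. *)
Let Kl := \sum_k adjoint G (ad br (ebas F k)) *m ad br (invmx G *m ebas F k).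
Let Kr := \sum_k ad br (invmx G *m ebas F k) *m adjoint G (ad br (ebas F k)).

Let ip_Kl v w : ip G (Kl *m v) w = \tr (ad br v *m adjoint G (ad br w)).
Proof.
case: sbr => _ _ skew.
rewrite /Kl mulmx_suml ip_suml mxtrace_mulC (mxtrace_ip metG).
apply: eq_bigr => k _; rewrite -!mulmxA !ip_adjointl // !adE //.
by rewrite skew (skew v) !(ipNl, ipNr metG) // (skew w) !(ipNl, ipNr metG).
Qed.

Let ip_Kr v w : ip G (Kr *m v) w = - \tr (coad br G v *m coad br G w).
Proof.
rewrite mxtrace_mulC -raddfN /= -mulNmx -(adjoint_coad sbr metG).
rewrite /Kr mulmx_suml ip_suml (mxtrace_ip_dual metG).
apply: eq_bigr => k _; rewrite -!mulmxA ip_adjointl // !coadE //.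
by rewrite ip_adjointr.
Qed.

(* In terms of [Kl] and [Kr] one has [Ric = - Kl / 2 + Kr / 4], while the
   derivation rule gives [\tr (Kl X) = \tr (Kr X) - \tr (Kl X)]. *)
Lemma mxtrace_Ric_derivation A X :
    (forall v, Ric br G v = A *m v) -> is_derivation br X ->
  \tr (A *m X) = 0.
Proof.
move=> RicA derX.
have four_neq0 : (4%:R : F) != 0 by rewrite (natrM _ 2 2) mulf_neq0.
have -> : A = - (2%:R^-1 *: Kl) + 4%:R^-1 *: Kr.
  apply: eq_mulmx_col => v; apply: (ip_inj metG) => w.
  rewrite -RicA -ric_Ric // nilpotent_ric mulmxDl mulNmx -!scalemxAl.
  by rewrite ipDl ipNl !ipZl ip_Kl ip_Kr mulrN.
have trKl : \tr (Kl *m X) = \tr (Kr *m X) - \tr (Kl *m X).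
  rewrite {1}(mxtrace_ip metG).
  (* [ip_Kl] at the vector [X] times the dual basis vector, whose [ad] is a commutator with [X];
     cyclicity then moves [X] to the right. *)
  have e k : ip G (Kl *m X *m (invmx G *m ebas F k)) (ebas F k)
      = \tr (ad br (invmx G *m ebas F k) *m adjoint G (ad br (ebas F k)) *m X)
      - \tr (adjoint G (ad br (ebas F k)) *m ad br (invmx G *m ebas F k) *m X).
    rewrite -mulmxA ip_Kl derivation_ad // mulmxBl raddfB /=.
    by rewrite -(mulmxA X) (mxtrace_mulC X) [in X in _ - X]mxtrace_mulC !mulmxA.
  rewrite (eq_bigr _ (fun k _ => e k)) sumrB /Kl /Kr !mulmx_suml.
  by rewrite -!raddf_sum.
have {}trKl : \tr (Kr *m X) = 2%:R * \tr (Kl *m X).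
  by rewrite mulr_natl mulr2n {1}trKl subrK.
rewrite mulmxDl mulNmx -!scalemxAl raddfD raddfN /= !mxtraceZ trKl.
(* The coefficients cancel: -1/2 + 2/4 = 0. *)
by field; rewrite four_neq0.
Qed.

End RicciTrace.
End NilpotentTraces.

(** * Coordinates on the operator algebra and its trace form *)

Section OperatorFamily.
Variables (F : fieldType) (n m : nat) (S : 'M[F]_(m, n * n)).
Implicit Types (v w : 'cV[F]_n) (x y : 'cV[F]_m).

Lemma opA_sum x : opA S x = \sum_j x j ord0 *: basA S j.
Proof.
rewrite /opA mulmx_sum_row linear_sum; apply: eq_bigr => j _.
by rewrite linearZ /= mxE.
Qed.

Lemma opA_lin a x y : opA S (a *: x + y) = a *: opA S x + opA S y.
Proof. by rewrite /opA !linearP /= mulmxDl -scalemxAl linearP. Qed.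

Lemma opA0 : opA S 0 = 0.
Proof. by rewrite /opA trmx0 mul0mx linear0. Qed.

Lemma mem_opA A : (mxvec A <= S)%MS -> exists x, opA S x = A.
Proof. by case/submxP => c e; exists c^T; rewrite /opA trmxK -e mxvecK. Qed.

Lemma coordA0 : coordA S 0 = 0.
Proof. by rewrite /coordA linear0 mul0mx trmx0. Qed.

Definition act v : 'M[F]_(n, m) := linmx (fun x => opA S x *m v).

Lemma actE v x : act v *m x = opA S x *m v.
Proof. by apply: linmxE => a y z; rewrite opA_lin mulmxDl -scalemxAl. Qed.

Lemma ip_trform a x y :
  ip (a *: trform S) x y = a * \tr (opA S x *m opA S y).
Proof.
rewrite /ip -scalemxAr -scalemxAl mxE; congr (_ * _).
rewrite [opA S x]opA_sum mulmx_suml raddf_sum /= -mulmxA mxE.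
apply: eq_bigr => i _; rewrite mxE -scalemxAl mxtraceZ; congr (_ * _).
rewrite opA_sum mulmx_sumr raddf_sum mxE /=.
by apply: eq_bigr => j _; rewrite mxE -scalemxAr mxtraceZ mulrC.
Qed.

Lemma tr_trform : (trform S)^T = trform S.
Proof. by apply/matrixP => i j; rewrite !mxE mxtrace_mulC. Qed.

End OperatorFamily.

Lemma inU_l (F : fieldType) n m (u : 'cV[F]_(n + m)) :
  inU (row_mx (1%:M : 'M[F]_n) (0 : 'M[F]_(n, m))) u = (dsubmx u == 0).
Proof.
rewrite /inU -[u]vsubmxK tr_col_mx col_mxKd; apply/submxP/eqP => [[c]|->].
  rewrite mul_mx_row mulmx1 mulmx0 => /eq_row_mx[_ /(congr1 trmx)].
  by rewrite trmxK trmx0.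
by exists (usubmx u)^T; rewrite mul_mx_row mulmx1 mulmx0 trmx0.
Qed.

Lemma inU_r (F : fieldType) n m (u : 'cV[F]_(n + m)) :
  inU (row_mx (0 : 'M[F]_(m, n)) (1%:M : 'M[F]_m)) u = (usubmx u == 0).
Proof.
rewrite /inU -[u]vsubmxK tr_col_mx col_mxKu; apply/submxP/eqP => [[c]|->].
  rewrite mul_mx_row mulmx1 mulmx0 => /eq_row_mx[/(congr1 trmx)].
  by rewrite trmxK trmx0.
by exists (dsubmx u)^T; rewrite mul_mx_row mulmx1 mulmx0 trmx0.
Qed.

(** * The semidirect product: block matrices, Ricci tensor, decomposition *)

Section EinsteinExtension.
Variables (F : fieldType) (n m : nat) (br : 'cV[F]_n -> 'cV[F]_n -> 'cV[F]_n).
Variables (G : 'M[F]_n) (lam : F) (D : 'M[F]_n) (S : 'M[F]_(m, n * n)).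
Hypothesis two_neq0 : (2%:R : F) != 0.
Hypothesis lieb : is_lie_bracket br.
Hypothesis nilb : nilpotent_br br.
Hypothesis metG : is_metric G.
Hypothesis lam_neq0 : lam != 0.
Hypothesis RicD : forall v, Ric br G v = lam *: v + D *m v.
Hypothesis derS : forall j, is_derivation br (basA S j) /\ self_adjoint G (basA S j).
Hypothesis commS : forall i j, (mxvec (comm_mx' (basA S i) (basA S j)) <= S)%MS.
Hypothesis memD : (mxvec D <= S)%MS.
Hypothesis unitS : trform S \in unitmx.
Implicit Types (v w : 'cV[F]_n) (x y : 'cV[F]_m) (p q : 'cV[F]_(n + m)).

Let sbr : skew_bilinear br := lie_skew_bilinear lieb.
Let H : 'M[F]_m := - lam^-1 *: trform S.

Lemma opA_derivation x : is_derivation br (opA S x).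
Proof.
have [_ _ skew] := sbr.
have br_sumr w f : br w (\sum_(j < m) f j) = \sum_j br w (f j).
  by rewrite -adE // mulmx_sumr; apply: eq_bigr => j _; rewrite adE.
move=> u v; rewrite opA_sum !mulmx_suml (skew (\sum_j _) v) !br_sumr -sumrN -big_split.
apply: eq_bigr => j _ /=; rewrite -skew -!scalemxAl (proj1 (derS j)).
have brZr a u' w : br w (a *: u') = a *: br w u' by rewrite -!adE // scalemxAr.
by rewrite (skew (_ *: _)) !brZr -scalerN -skew scalerDr.
Qed.

Lemma adjoint_opA x : adjoint G (opA S x) = opA S x.
Proof.
apply/self_adjointE => //; rewrite /self_adjoint opA_sum linear_sum mulmx_suml mulmx_sumr.
apply: eq_bigr => j _; rewrite linearZ /= -scalemxAl -scalemxAr.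
by rewrite (proj2 (derS j)).
Qed.

Lemma ip_opA x v w : ip G (opA S x *m v) w = ip G v (opA S x *m w).
Proof. by rewrite -{1}adjoint_opA ip_adjointl. Qed.

(* The commutator of two self-adjoint operators is skew-adjoint; lying in the
   span of [S], it is also self-adjoint. *)
Lemma opA_comm x y : comm_mx' (opA S x) (opA S y) = 0.
Proof.
have comm_basA i j : basA S i *m basA S j = basA S j *m basA S i.
  have [z opz] := mem_opA (commS i j).
  have sA k : adjoint G (basA S k) = basA S k.
    by apply/self_adjointE => //; case: (derS k).
  have := adjoint_opA z; rewrite opz /comm_mx' adjointD adjointN !adjointM // !sA.
  rewrite -[LHS]opprB => /eqP; rewrite eq_sym -addr_eq0 -mulr2n -scaler_nat.
  by rewrite scaler_eq0 (negPf two_neq0) subr_eq0 => /eqP.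
apply/eqP; rewrite subr_eq0 !opA_sum mulmx_suml [eqbRHS]mulmx_sumr; apply/eqP.
apply: eq_bigr => i _; rewrite mulmx_sumr [RHS]mulmx_suml; apply: eq_bigr => j _.
by rewrite -!scalemxAl -!scalemxAr comm_basA !scalerA mulrC.
Qed.

(** The lower block vanishes because the operators [opA] commute; every bracket therefore lies in
    the nilpotent factor. *)
Lemma sd_brE v x w y : sd_br br S (col_mx v x) (col_mx w y) =
  col_mx (br v w + opA S x *m w - opA S y *m v) 0.
Proof. by rewrite /sd_br !col_mxKu !col_mxKd opA_comm coordA0. Qed.

Lemma sd_skew_bilinear : skew_bilinear (sd_br br S).
Proof.
have [brl _ skew] := sbr.
have sd_skew p q : sd_br br S p q = - sd_br br S q p.
  rewrite -(vsubmxK p) -(vsubmxK q) !sd_brE opp_col_mx oppr0; congr col_mx.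
  by rewrite skew !opprD opprK addrAC.
have sd_linl a p q r :
    sd_br br S (a *: p + q) r = a *: sd_br br S p r + sd_br br S q r.
  rewrite -(vsubmxK p) -(vsubmxK q) -(vsubmxK r) scale_col_mx add_col_mx !sd_brE.
  rewrite scale_col_mx add_col_mx scaler0 addr0; congr col_mx.
  rewrite brl opA_lin mulmxDl mulmxDr -scalemxAl -scalemxAr.
  rewrite scalerBr scalerDr opprD !addrA; congr (_ - _).
  by rewrite [X in _ = X + _]addrAC [RHS]addrAC [X in _ = X + _ - _]addrAC.
split=> // a p q r.
by rewrite sd_skew sd_linl opprD -scalerN -!sd_skew.
Qed.

Lemma metH : is_metric H.
Proof.
split; first by rewrite /H linearZ /= tr_trform.
by rewrite unitmxZ // unitfE oppr_eq0 invr_eq0.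
Qed.

Let Gt := sd_metric G S lam.

Lemma ip_sd v x w y : ip Gt (col_mx v x) (col_mx w y) = ip G v w + ip H x y.
Proof.
rewrite /ip /Gt /sd_metric -/H tr_col_mx mul_row_block !mulmx0 addr0 add0r.
by rewrite mul_row_col mxE.
Qed.

Lemma sd_is_metric : is_metric Gt.
Proof.
split; first by rewrite tr_block_mx (proj1 metG) (proj1 metH) !trmx0.
by rewrite unitmxE det_ublock unitrM -!unitmxE (proj2 metG) (proj2 metH).
Qed.

(** The adjoint of [act S v] with respect to the metrics [H] and [G]. *)
Definition tract v : 'M[F]_(m, n) := invmx H *m (act S v)^T *m G.

Lemma ip_tract v w x : ip H (tract v *m w) x = ip G w (opA S x *m v).
Proof.
rewrite (ipC metH) (ipC metG) -actE /ip /tract trmx_mul !mulmxA.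
by rewrite mulmxK ?(proj2 metH).
Qed.

Lemma ad_sd v x :
  ad (sd_br br S) (col_mx v x) = block_mx (ad br v + opA S x) (- act S v) 0 0.
Proof.
apply: eq_mulmx_col => p; rewrite (adE sd_skew_bilinear) -(vsubmxK p) sd_brE.
by rewrite mul_block_col !mul0mx addr0 mulNmx actE mulmxDl adE.
Qed.

Lemma adjoint_ad_sd v x : adjoint Gt (ad (sd_br br S) (col_mx v x)) =
  block_mx (adjoint G (ad br v) + opA S x) 0 (- tract v) 0.
Proof.
apply: eq_mulmx_col => p; apply: (ip_inj sd_is_metric) => q.
rewrite (ip_adjointl sd_is_metric) ad_sd -(vsubmxK p) -(vsubmxK q).
rewrite !mul_block_col !mul0mx !addr0 !ip_sd !mulNmx ipNl ip_tract.
rewrite !mulmxDl ipDl ip_adjointl // ip_opA.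
by rewrite !ipDr // actE ipNr // ip0r addr0.
Qed.

(** Brackets lie in the nilpotent factor, which is orthogonal to [x], so only [v] enters. *)
Lemma coad_sd v x : coad (sd_br br S) Gt (col_mx v x) =
  block_mx (coad br G v) (act S v) (- tract v) 0.
Proof.
apply: eq_mulmx_col => p; apply: (ip_inj sd_is_metric) => q.
rewrite (ip_coad sd_skew_bilinear sd_is_metric) -(vsubmxK p) -(vsubmxK q).
rewrite sd_brE !mul_block_col !mul0mx !addr0 !ip_sd !mulNmx ipNl ip_tract.
rewrite ipDl ip_coad // actE !ipDr // ipNr // ip0r addr0.
by rewrite (ipC metG (usubmx p) (_ *m v)) !ip_opA.
Qed.

(** The Ricci operator [lam + D] is trace-orthogonal to the derivation [opA S x]; hence [lam] times
    its trace is minus the trace of [D *m opA S x]. This is what fixes the factor -1/[lam] in the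
    metric. *)
Lemma mxtrace_opA x d : opA S d = D -> \tr (opA S x) = ip H d x.
Proof.
move=> opd; rewrite ip_trform opd.
have /(mxtrace_Ric_derivation lieb nilb metG two_neq0) :
    forall v, Ric br G v = (lam%:M + D) *m v.
  by move=> v; rewrite mulmxDl mul_scalar_mx RicD.
move=> /(_ _ (opA_derivation x)); rewrite mulmxDl mul_scalar_mx mxtraceD mxtraceZ.
by move/eqP; rewrite addr_eq0 => /eqP e; rewrite mulNr -mulrN -e mulKf.
Qed.

Lemma mxtrace_ad_sd p d : opA S d = D ->
  \tr (ad (sd_br br S) p) = ip Gt (col_mx 0 d) p.
Proof.
move=> opd; rewrite -(vsubmxK p) ad_sd mxtrace_block mxtrace0 addr0 mxtraceD.
rewrite (mxtrace_ad lieb nilb) (mxtrace_opA _ opd) ip_sd; congr (_ + _).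
by rewrite ip0l.
Qed.

(** The trace is the inner product of the connection term with [(0, D)]. Of the three terms of
    [conn], the bracket is orthogonal to [(0, D)], and the other two each give half of the result
    since [D] is self-adjoint. *)
Lemma mxtrace_ad_levi_civita_sd v x w y :
  \tr (ad (sd_br br S) (levi_civita (sd_br br S) Gt (col_mx v x) (col_mx w y)))
  = ip G (D *m v) w.
Proof.
have [d opd] := mem_opA memD.
rewrite (mxtrace_ad_sd _ opd) (levi_civita_conn sd_skew_bilinear sd_is_metric) //.
rewrite mulNmx (ipNr sd_is_metric) -scalemxAl (ipZr sd_is_metric).
rewrite !mulmxDl !(ipDr sd_is_metric) (ip_adjointr sd_is_metric) !(adE sd_skew_bilinear).
rewrite (ipC sd_is_metric _ (coad _ _ _ *m _)) (ip_coad sd_skew_bilinear sd_is_metric).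
rewrite !sd_brE !ip_sd opd !mulmx0 !addr0 !ip0l !ip0r -!(adE sbr) !mulmx0 !sub0r.
rewrite (ipNl _ (D *m w)) (ipNr metG) -opd (ip_opA d w) (ipC metG w); by field.
Qed.

(** An operator and its adjoint have equal trace, and [tract] is the adjoint of [act]. *)
Lemma mxtrace_tract v w : \tr (act S v *m tract w) = \tr (tract v *m act S w).
Proof.
rewrite [RHS]mxtrace_mulC -[RHS]mxtrace_tr /tract !trmx_mul (proj1 metG).
by rewrite trmx_inv (proj1 metH) trmxK -(mulmxA G) [RHS]mxtrace_mulC !mulmxA.
Qed.

Lemma ric_sd p q : ric (sd_br br S) Gt p q = lam * ip Gt p q.
Proof.
rewrite -(vsubmxK p) -(vsubmxK q); move: (usubmx p) (dsubmx p) (usubmx q) (dsubmx q).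
move=> v x w y.
have four_neq0 : (4%:R : F) != 0 by rewrite (natrM _ 2 2) mulf_neq0.
rewrite (ric_trace sd_skew_bilinear sd_is_metric) // mxtrace_ad_levi_civita_sd.
rewrite adjoint_ad_sd !ad_sd !coad_sd !mulmx_block !mxtrace_block.
rewrite !mul0mx !mulmx0 !addr0 !mxtraceD !mulNmx !mulmxN opprK !raddfN /= mxtrace0.
(* The off-diagonal blocks now all contribute one trace T: -T/2 from [ad] against its adjoint, and
   +2T/4 from the [coad] product. *)
rewrite mxtrace_tract.
rewrite !mulmxDl !mulmxDr !mxtraceD.
have trX := mxtrace_ad_derivation lieb nilb _ (opA_derivation _).
have trXa z u : \tr (opA S z *m adjoint G (ad br u)) = 0.
  by rewrite -{1}adjoint_opA -adjointM // mxtrace_adjoint // trX.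
rewrite !trX trXa (mxtrace_mulC (opA S x) (ad br w)) trX.
rewrite (mxtrace_ad_derivation lieb nilb _ (ad_derivation lieb w)).
have := nilpotent_ric lieb nilb metG two_neq0 v w.
rewrite (ric_Ric sbr metG) // RicD ipDl ipZl ip_sd /H ip_trform => ricv.
(* Completes the [D] term to [lam * ip G v w + ip G (D *m v) w], the Ricci tensor of the nilpotent
   factor, so that [ricv] replaces it by traces. *)
rewrite -[ip G (D *m v) w](addKr (lam * ip G v w)) ricv.
by field; rewrite lam_neq0 four_neq0.
Qed.

Lemma Ric_sd p : Ric (sd_br br S) Gt p = lam *: p.
Proof.
apply: (Ric_eq sd_skew_bilinear sd_is_metric two_neq0) => q.
by rewrite ric_sd ipZl.
Qed.

Lemma sd_pseudo_iwasawa : pseudo_iwasawa (sd_br br S) Gt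
  (row_mx (1%:M : 'M[F]_n) (0 : 'M[F]_(n, m)))
  (row_mx (0 : 'M[F]_(m, n)) (1%:M : 'M[F]_m)).
Proof.
have inUl p : inU (row_mx 1%:M 0) p -> p = col_mx (usubmx p) 0.
  by rewrite inU_l => /eqP <-; rewrite vsubmxK.
have inUr p : inU (row_mx 0 1%:M) p -> p = col_mx 0 (dsubmx p).
  by rewrite inU_r => /eqP <-; rewrite vsubmxK.
split.
- split; last by move=> p q /inUl-> /inUr->; rewrite ip_sd ip0r ip0l addr0.
  rewrite submx1 /= (scalar_mx_block n m 1) /block_mx.
  rewrite col_mx_sub addsmxSl addsmxSr /=.
  apply/mxdirect_addsP/eqP/rowV0P => c.
  rewrite sub_capmx -[c]trmxK => /andP[/inUl e1 /inUr e2].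
  by rewrite e1 (congr1 usubmx e2) col_mxKu col_mx0 trmx0.
- move=> p q /inUl->; rewrite -(vsubmxK p) sd_brE.
  by rewrite inU_l col_mxKd.
(* On vectors with zero lower part the iterated brackets are those of [br], so the same length [k]
   works. *)
- have [k nilk] := nilb; exists k => s p sU /inUl->.
  suff -> : iter_br (sd_br br S) s (col_mx (usubmx p) 0)
      = col_mx (iter_br br (map usubmx s) (usubmx p)) 0.
    by move=> sz; rewrite nilk ?size_map // col_mx0.
  elim: s sU => //= q s IHs /andP[/inUl-> /IHs->].
  by rewrite sd_brE opA0 !mul0mx addr0 subr0 col_mxKu.
- move=> p q /inUr-> /inUr->; rewrite sd_brE !mulmx0 -(adE sbr) mulmx0.
  by rewrite addr0 subr0 col_mx0.
(* With [X] in the abelian factor, [ad X] acts only on upper parts, as an operator [opA], which is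
   self-adjoint. *)
- move=> p q r /inUr->; rewrite -(vsubmxK q) -(vsubmxK r) !sd_brE !mulmx0 !subr0.
  by rewrite -!(adE sbr) (ad0 sbr) !mul0mx !add0r !ip_sd ip_opA ip0l ip0r.
Qed.

End EinsteinExtension.

Theorem theorem4p1 (R : realType) (n m : nat)
  (br : 'cV[R]_n -> 'cV[R]_n -> 'cV[R]_n) (G : 'M[R]_n)
  (lam : R) (D : 'M[R]_n) (S : 'M[R]_(m, n * n)) :
  is_lie_bracket br -> nilpotent_br br -> is_metric G ->
  lam != 0 ->
  is_derivation br D ->
  (forall v, Ric br G v = lam *: v + D *m v) ->
  row_free S ->
  (forall j, is_derivation br (basA S j) /\ self_adjoint G (basA S j)) ->
  (forall i j, (mxvec (comm_mx' (basA S i) (basA S j)) <= S)%MS) ->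
  (mxvec D <= S)%MS ->
  trform S \in unitmx ->
  (forall v, Ric (sd_br br S) (sd_metric G S lam) v = lam *: v) /\
  pseudo_iwasawa (sd_br br S) (sd_metric G S lam)
    (row_mx (1%:M : 'M[R]_n) (0 : 'M[R]_(n, m)))
    (row_mx (0 : 'M[R]_(m, n)) (1%:M : 'M[R]_m)).
Proof.
move=> lieb nilb metG lam_neq0 _ RicD _ derS commS memD unitS.
have two_neq0 : (2%:R : R) != 0 by rewrite pnatr_eq0.
split=> [v|]; first exact: (@Ric_sd _ _ _ br G lam D).
exact: sd_pseudo_iwasawa.
Qed.
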